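(* Let $R$ be a random variable with $R > 0$ and let $\Theta$ be independent of $R$ and uniformly distributed on $(-\pi, \pi)$. Suppose that the distribution function $F_R$ of $R$ has unbounded support and is absolutely continuous with density $f_R$, and write $\overline{F}_R = 1 - F_R$. For $\rho \in [-1, 1]$ let $C_\rho$ be the bivariate elliptical copula with correlation parameter $\rho$ and radius $R$, and let $\lambda_\rho(u) = u^{-1} \, C_\rho(u, u)$ for $0 < u \le 1$. If \[ \liminf_{r \to \infty} \frac{r \, f_R(r)}{\overline{F}_R(r)} > 1, \] then there exists $u_0 \in (0, 1/2)$ such that the function $\rho \mapsto \lambda_\rho(u)$ is convex in $\rho \in [-1, 1]$ for every $u \in (0, u_0)$. If moreover the limit $\lambda_\rho = \lim_{u \downarrow 0} \lambda_\rho(u)$ exists, then $\lambda_\rho$ is convex in $\rho \in [-1, 1]$.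
   Context: The elliptical copula $C_\rho$ is defined as follows. Put $(S_1, S_2) = (R \cos \Theta, R \sin \Theta)$ and, for $-1 \le \rho \le 1$, let $(X, Y) = \bigl(S_1, \, \rho S_1 + (1 - \rho^2)^{1/2} S_2\bigr)$. The variables $X$, $Y$, $S_1$, $S_2$ have a common distribution function $F$, not depending on $\rho$. Then $C_\rho(u, v) = \Pr(U \le u, V \le v)$ for $(u, v) \in [0, 1]^2$, where $U = F(X)$ and $V = F(Y)$. The distribution of $R$ is fixed, and $C_\rho$ is viewed as a family parameterized by $\rho$. The quantity $\lambda_\rho(u)$ is called the coefficient of penultimate tail dependence, and its limit $\lambda_\rho$ as $u \downarrow 0$, if it exists, the coefficient of tail dependence. *)

(* Defs.v *)
From HB Require Import structures.
From mathcomp Require Import all_boot all_order all_algebra.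
From mathcomp Require Import all_classical all_reals all_analysis.
From mathcomp Require Import measurable_realfun.
Set Implicit Arguments.
Unset Strict Implicit.
Unset Printing Implicit Defensive.
Import Order.TTheory GRing.Theory Num.Theory.
Import numFieldNormedType.Exports.
Local Open Scope classical_set_scope.
Local Open Scope ring_scope.

Section random_variables.
Context {d : measure_display} {T : measurableType d} {R : realType}.
Variable P : probability T R.

Definition independent_RV (X Y : {RV P >-> R}) : Prop :=
  forall A B : set R, measurable A -> measurable B ->
    P (X @^-1` A `&` Y @^-1` B) = (P (X @^-1` A) * P (Y @^-1` B))%E.

(* The library's [uniform_prob] lives on the closed interval; since its
   endpoints are null, it is also the uniform law on the open one. *)
Definition uniform_RV (a b : R) (X : {RV P >-> R}) : Prop :=
  exists ab : a < b, forall A : set R, measurable A ->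
    distribution P X A = uniform_prob ab A.

Definition has_density (X : {RV P >-> R}) (f : R -> R) : Prop :=
  [/\ measurable_fun setT f, forall x, 0 <= f x &
      forall x,
        (cdf X x = \int[lebesgue_measure]_(t in `]-oo, x]) (f t)%:E)%E].

(* The points of increase of the distribution function. *)
Definition cdf_support (X : {RV P >-> R}) : set R :=
  [set x | forall e : R, 0 < e -> (cdf X (x - e) < cdf X (x + e))%E].

End random_variables.

Section elliptical_copula.
Context {d : measure_display} {T : measurableType d} {R : realType}.
Variable P : probability T R.
Variables Rad Theta : {RV P >-> R}.

Definition spherical1 : T -> R := fun w => Rad w * cos (Theta w).
Definition spherical2 : T -> R := fun w => Rad w * sin (Theta w).

Lemma measurable_spherical1 : measurable_fun setT spherical1.
Proof.
apply: measurable_funM; first exact: measurable_funPT.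
apply: measurableT_comp; last exact: measurable_funPT.
exact: continuous_measurable_fun (@continuous_cos R).
Qed.

HB.instance Definition _ :=
  isMeasurableFun.Build _ _ _ _ spherical1 measurable_spherical1.

Definition elliptical_X : T -> R := spherical1.
Definition elliptical_Y (rho : R) : T -> R :=
  fun w => rho * spherical1 w + Num.sqrt (1 - rho ^+ 2) * spherical2 w.

(* When [Theta] is independent of [Rad] and uniform on a full turn, the pair
   ([spherical1], [spherical2]) is rotationally invariant, so this is also the
   distribution function of [spherical2] and of [elliptical_Y rho]. *)
Definition elliptical_cdf (x : R) : R :=
  fine (cdf (spherical1 : {RV P >-> R}) x).

Definition elliptical_copula (rho u v : R) : R :=
  fine (P [set w | elliptical_cdf (elliptical_X w) <= u /\
                   elliptical_cdf (elliptical_Y rho w) <= v]).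

Definition penultimate_tail_dependence (rho u : R) : R :=
  u^-1 * elliptical_copula rho u u.

Definition tail_dependence (rho : R) : R :=
  lim (penultimate_tail_dependence rho u @[u --> 0^'+]).

End elliptical_copula.

(* Main.v *)
(* With [rho = cos (2 b)], both components of the elliptical vector lie below
   [- q] exactly when [Rad * cos (|phi| + b) >= q], where [phi] is the angle
   measured from the opposite of the bisector of the two axes; hence
   [pi * C_rho (u, u) = \int_b^(pi/2) k], where [k t] is the probability that
   [Rad * cos t >= q].  The condition on the liminf makes [r * P (Rad > r)]
   nonincreasing for large [r], so that [k t / cos t], and a fortiori
   [k t / (sin t * cos t)], is nonincreasing on [(0, pi/2)].  Since
   [\int_b^c sin t * cos t dt] is affine in [cos (2 b)] and [cos (2 c)],
   comparing [k] with the multiple of [sin * cos] that agrees with it at [b]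
   yields a subgradient of [rho |-> C_rho (u, u)] at every interior [rho]. *)

Require Import Defs.
From HB Require Import structures.
From mathcomp Require Import all_boot all_order all_algebra.
From mathcomp Require Import all_classical all_reals all_analysis.
From mathcomp Require Import measurable_realfun lra ring.
Import Order.TTheory GRing.Theory Num.Theory.
Import numFieldNormedType.Exports.
Local Open Scope classical_set_scope.
Local Open Scope ring_scope.

(** * Convexity from subgradients *)

Lemma subgradient_convex (R : realType) (a b : R) (phi : R -> R) :
  (forall x, a < x < b ->
     exists s, forall y, a <= y <= b -> phi x + s * (y - x) <= phi y) ->
  @convex_function R R^o `[a, b] phi.
Proof.
move=> sub.
suff key (p x y : R) : 0 <= p <= 1 -> a <= x <= b -> a <= y <= b ->
    phi (p * x + (1 - p) * y) <= p * phi x + (1 - p) * phi y.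
  move=> t x y; rewrite !inE/= => xab yab; rewrite !convRE.
  by apply: key => //; apply/andP.
move=> /andP[p0 p1] xab yab.
case/andP: (xab) => ax xb; case/andP: (yab) => ay yb.
set m := p * x + (1 - p) * y; have mE : m = p * x + (1 - p) * y by [].
have [p_eq0|p_neq0] := eqVneq p 0.
  by rewrite mE p_eq0 !mul0r subr0 !mul1r !add0r.
have [p_eq1|p_neq1] := eqVneq p 1.
  by rewrite mE p_eq1 subrr !mul0r !mul1r !addr0.
have [xy|xy] := eqVneq x y; first by rewrite mE xy -!mulrDl (addrC p) subrK !mul1r.
have p_gt0 : 0 < p by rewrite lt_def p_neq0.
have q_gt0 : 0 < 1 - p by rewrite subr_gt0 lt_def eq_sym p_neq1.
(* A proper combination of two distinct points of [[a, b]] is interior, which is why subgradients at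
   interior points suffice. *)
have ab_m : a < m < b.
  apply/andP; rewrite mE; clear -p_gt0 q_gt0 ax xb ay yb xy.
  by case: (ltgtP x y) xy => // xy _; split; nra.
have [s ms] := sub _ ab_m.
have mx := ler_wpM2l p0 (ms _ xab); have my := ler_wpM2l (ltW q_gt0) (ms _ yab).
apply: le_trans (lerD mx my); rewrite le_eqVlt; apply/orP; left; apply/eqP.
by rewrite mE; ring.
Qed.

(** * Translation, reflection and periodicity of Lebesgue integrals; integrals over arcs of the
    circle *)

Section integral_shift.
Context {R : realType}.
Local Notation mu := (@lebesgue_measure R).
Local Open Scope ereal_scope.

Lemma lebesgue_measure_shift (a : R) (A : set R) : measurable A ->
  pushforward mu ((fun x => x + a)%R : R -> measurableTypeR R) A = mu A.
Proof.
have ms : measurable_fun setT ((fun x => x + a)%R : R -> measurableTypeR R).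
  exact: measurable_funD.
move=> mA; apply/esym/lebesgue_measure_unique => //= _ [[b c]] _ <-.
rewrite /pushforward.
rewrite (_ : _ @^-1` _ = `](b - a)%R, (c - a)%R]%classic); last first.
  by apply/seteqP; split => x /=; rewrite !in_itv/= ltrBlDr lerBrDr.
rewrite !lebesgue_measure_itv/= !lte_fin ltrD2r.
by case: ifP => // _; congr (_%:E); ring.
Qed.

Lemma ge0_integral_shift (a : R) (D : set R) (g : R -> \bar R) :
  measurable D -> measurable_fun setT g -> (forall x, 0 <= g x) ->
  \int[mu]_(x in (fun x => x + a)%R @^-1` D) g (x + a)%R = \int[mu]_(x in D) g x.
Proof.
move=> mD mg g0.
have ms : measurable_fun setT
    ((fun x => x + a)%R : measurableTypeR R -> measurableTypeR R).
  exact: measurable_funD.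
rewrite -(@ge0_integral_pushforward _ _ _ (measurableTypeR R) R _ ms mu D g)//.
  by apply: eq_measure_integral => A mA _; exact: lebesgue_measure_shift.
exact: measurable_funTS.
Qed.

Lemma ge0_integralN (D : set R) (g : R -> \bar R) :
  measurable D -> measurable_fun setT g -> (forall x, 0 <= g x) ->
  \int[mu]_(x in -%R @^-1` D) g (- x)%R = \int[mu]_(x in D) g x.
Proof.
move=> mD mg g0.
have ms : measurable_fun setT (-%R : measurableTypeR R -> measurableTypeR R).
  exact: oppr_measurable.
rewrite -(@ge0_integral_pushforward _ _ _ (measurableTypeR R) R _ ms mu D g)//.
  by apply: eq_measure_integral => A mA _; exact: lebesgue_measureN.
exact: measurable_funTS.
Qed.

Lemma ge0_integral_itvcc_split (x y z : R) (g : R -> \bar R) :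
  (x <= y <= z)%R -> measurable_fun setT g -> (forall x, 0 <= g x) ->
  \int[mu]_(t in `[x, z]) g t =
  \int[mu]_(t in `[x, y]) g t + \int[mu]_(t in `[y, z]) g t.
Proof.
move=> /andP[xy yz] mg g0.
(* The shared endpoint [y] is null; dropping it from the first piece makes the two pieces
   disjoint. *)
rewrite -(@integral_itv_bndo_bndc _ _ y); last exact: measurable_funTS.
rewrite -ge0_integral_setU//=.
- by rewrite -itv_bndbnd_setU// bnd_simp.
- by apply: measurable_funTS.
- by apply/disj_setPRL => t/=; rewrite !in_itv/= => /andP[yt _];
    rewrite (ltNge t y) yt andbF.
Qed.

(** The shifted window is cut at [b + p] and the original one at [b + a]. They share
    [[b + a, b + p]], and the two remaining pieces are translates of each other by [p]. *)
Lemma ge0_integral_periodic (b p a : R) (g : R -> \bar R) :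
  (0 <= a <= p)%R -> (forall x, g (x + p)%R = g x) ->
  measurable_fun setT g -> (forall x, 0 <= g x) ->
  \int[mu]_(x in `[b, (b + p)%R]) g (x + a)%R = \int[mu]_(x in `[b, (b + p)%R]) g x.
Proof.
move=> /andP[a0 ap] gp mg g0.
rewrite [X in integral _ X _ = _](_ : _ =
    (fun x => x + a)%R @^-1` `[(b + a)%R, (b + a + p)%R])/=; last first.
  by apply/seteqP; split => x /=; rewrite !in_itv/= lerD2r (addrAC b) lerD2r.
rewrite ge0_integral_shift// (@ge0_integral_itvcc_split _ (b + p)%R)//; last first.
  by rewrite lerD2l ap addrAC lerDl.
rewrite [RHS](@ge0_integral_itvcc_split _ (b + a)%R)//;
  last by rewrite lerDl a0 lerD2l.
rewrite addeC; congr (_ + _).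
rewrite -(@ge0_integral_shift p)//; under eq_integral do rewrite gp.
by congr (integral _ _ _); apply/seteqP; split => x /=; rewrite !in_itv/= !lerD2r.
Qed.

End integral_shift.

(** The directions [0] and [b *+ 2] have bisector [b]. Measured from the opposite direction
    [b + pi], the larger cosine becomes [- cos (|t| + b)], an even function of [t]; each half circle
    thus contributes the same integral, and [K] cuts it off at [pi / 2]. *)
Lemma ge0_integral_circle_max (R : realType) (K : R -> \bar R) (b : R) :
  measurable_fun setT K -> (forall x, (0 <= K x)%E) ->
  (forall x, 0 <= x -> K x = 0%E) -> 0 <= b <= pi / 2 ->
  (\int[lebesgue_measure]_(t in `[(- pi)%R, pi])
     K (Num.max (cos t) (cos (t - b *+ 2)))%R =
   \int[lebesgue_measure]_(t in `[b, (pi / 2)%R]) K (- cos t)%R *+ 2)%E.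
Proof.
move=> mK K0 K_eq0 /andP[b0 bpi].
have pi0 := pi_ge0 R.
have mcos : measurable_fun setT (@cos R).
  exact: continuous_measurable_fun (@continuous_cos R).
have mcosD (c : R) : measurable_fun setT (fun t : R => cos (t + c)).
  by apply: measurableT_comp => //; exact: measurable_funD.
have mM : measurable_fun setT (fun t : R => K (Num.max (cos t) (cos (t - b *+ 2)))).
  by apply: measurableT_comp => //; exact: measurable_maxr.
have mk : measurable_fun setT (fun t : R => K (- cos t)).
  apply: measurableT_comp => //; exact: (measurableT_comp _ mcos).
have mkb : measurable_fun setT (fun t : R => K (- cos (t + b))).
  apply: measurableT_comp => //; exact: (measurableT_comp _ (mcosD b)).
have piE : - pi + pi *+ 2 = pi :> R by rewrite mulr2n addrA addNr add0r.
have := @ge0_integral_periodic _ (- pi) (pi *+ 2) (b + pi)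
  (fun t => K (Num.max (cos t) (cos (t - b *+ 2)))).
rewrite piE => <- //; last 2 first.
- by apply/andP; split; rewrite ?mulr2n; lra.
- by move=> x; rewrite addrAC !cosD2pi.
rewrite (@ge0_integral_itvcc_split _ _ 0)//; last 2 first.
- by rewrite oppr_le0 pi0.
- apply: measurableT_comp => //; apply: measurable_maxr => //.
  under eq_fun do rewrite -addrA; exact: mcosD.
have maxE t : 0 <= sin t ->
    Num.max (cos (t + (b + pi))) (cos (t + (b + pi) - b *+ 2)) = - cos (t + b) /\
    Num.max (cos (- t + (b + pi))) (cos (- t + (b + pi) - b *+ 2)) = - cos (t + b).
  move=> sint.
  (* Since [sin t] and [sin b] are nonnegative, [cos (t + b) <= cos (t - b)], which decides both
     maxima. *)
  have shiftE x : x + (b + pi) - b *+ 2 = x - b + pi by ring.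
  have sinb : 0 <= sin b by apply: sin_ge0_pi; apply/andP; split; lra.
  have cosb : cos (t + b) <= cos (t - b) by rewrite cosD cosB; nra.
  rewrite !shiftE !(addrA _ b pi) !cosDpi.
  rewrite (_ : - t + b = - (t - b)); last by ring.
  rewrite (_ : - t - b = - (t + b)); last by ring.
  by rewrite !cosN; split; [rewrite max_l|rewrite max_r] => //; rewrite lerN2.
have halfE : (\int[lebesgue_measure]_(t in `[0%R, pi]) K (- cos (t + b))%R =
    \int[lebesgue_measure]_(t in `[b, (pi / 2)%R]) K (- cos t)%R)%E.
  rewrite [X in integral _ X _ = _](_ : _ = (fun x => x + b) @^-1` `[b, pi + b])/=; last first.
    by apply/seteqP; split => x /=; rewrite !in_itv/= lerD2r lerDr.
  rewrite (@ge0_integral_shift _ _ _ (fun t : R => K (- cos t)))//.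
  rewrite (@ge0_integral_itvcc_split _ _ (pi / 2))//; last first.
    by rewrite bpi/=; lra.
  (* On [[pi / 2, pi + b]] the cosine is nonpositive because [b <= pi / 2], so [K] is evaluated
     where it vanishes. *)
  rewrite [X in (_ + X)%E]integral0_eq ?adde0// => t /=;
    rewrite in_itv/= => /andP[t1 t2].
  rewrite K_eq0// oppr_ge0 -[t](subrK pi) cosDpi oppr_le0.
  by apply: cos_ge0_pihalf; apply/andP; split; lra.
congr (_ + _)%E; last first.
  rewrite -halfE; apply: eq_integral => t; rewrite inE/= in_itv/= => tpi.
  by rewrite (maxE t (sin_ge0_pi tpi)).1.
rewrite -halfE -[RHS]ge0_integralN//.
rewrite [X in _ = integral _ X _](_ : _ = `[- pi, 0]%classic)/=; last first.
  by apply/seteqP; split => x /=; rewrite !in_itv/= oppr_ge0 lerNl andbC.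
apply: eq_integral => t; rewrite inE/= in_itv/= => /andP[t1 t2].
have sint : 0 <= sin (- t) by apply: sin_ge0_pi; apply/andP; split; lra.
by rewrite -{1 2}(opprK t) (maxE _ sint).2.
Qed.

Lemma Rintegral_sin_cos (R : realType) (x y : R) : x <= y ->
  \int[lebesgue_measure]_(t in `[x, y]) (sin t * cos t) =
  (sin y ^+ 2 - sin x ^+ 2) / 2 :> R.
Proof.
rewrite le_eqVlt => /predU1P[<-|xy].
  by rewrite set_itv1 Rintegral_set1 subrr mul0r.
have dsin2 (t : R) : is_derive t 1 (fun t => sin t ^+ 2 / 2) (sin t * cos t).
  apply: is_derive_eq; rewrite /GRing.scale/=.
  by field.
rewrite /Rintegral (@continuous_FTC2 _ _ (fun t => sin t ^+ 2 / 2))//=.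
- by rewrite -mulrBl.
- apply: continuous_subspaceT => t.
  by apply: cvgM; [exact: continuous_sin|exact: continuous_cos].
- have ct (t : R) : {for t, continuous (fun t : R => sin t ^+ 2 / 2)}.
    by apply: differentiable_continuous; apply/derivable1_diffP.
  split; first by move=> t _.
  + by apply: cvg_at_right_filter; exact: ct.
  + by apply: cvg_at_left_filter; exact: ct.
- by move=> t _; rewrite derive1E; apply: derive_val.
Qed.

(** The third hypothesis says that [k / (sin * cos)] is nonincreasing, cross-multiplied because the
    denominator vanishes at [0] and [pi / 2]. A multiple of [sin * cos] that meets [k] at [b] lies
    below [k] to the left of [b] and above it to the right; both comparisons push the integral in
    the same direction. *)
Lemma arc_integral_subgradient (R : realType) (k : R -> R) (b : R) :
  measurable_fun setT k -> (forall t, 0 <= k t <= 1) ->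
  (forall x y, 0 <= x -> x <= y -> y <= pi / 2 ->
     k y * (sin x * cos x) <= k x * (sin y * cos y)) ->
  0 < b < pi / 2 ->
  exists s, forall c, 0 <= c <= pi / 2 ->
    \int[lebesgue_measure]_(t in `[b, pi / 2]) k t
      + s * (sin b ^+ 2 - sin c ^+ 2)
    <= \int[lebesgue_measure]_(t in `[c, pi / 2]) k t.
Proof.
move=> mk k01 kmono /andP[b0 bpi].
have ik x y : lebesgue_measure.-integrable `[x, y] (EFin \o k).
  apply: measurable_bounded_integrable => //.
  - by rewrite /= lebesgue_measure_itv/=; case: ifP; rewrite ltry.
  - exact: measurable_funTS.
  - exists 1; split=> // M M1 t _ /=; have /andP[k0 k1] := k01 t.
    by rewrite ger0_norm// (le_trans k1)// ltW.
have isc x y : lebesgue_measure.-integrable `[x, y]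
    (EFin \o (fun t : R => sin t * cos t)).
  apply: continuous_compact_integrable; first exact: segment_compact.
  apply: continuous_subspaceT => t.
  by apply: cvgM; [exact: continuous_sin|exact: continuous_cos].
have splitk x y z : x <= y <= z ->
    \int[lebesgue_measure]_(t in `[x, z]) k t =
    \int[lebesgue_measure]_(t in `[x, y]) k t +
      \int[lebesgue_measure]_(t in `[y, z]) k t.
  move=> xyz; rewrite /Rintegral (@ge0_integral_itvcc_split _ x y z)//.
  - by rewrite fineD//; apply: integrable_fin_num.
  - exact/measurable_EFinP.
  - by move=> t; rewrite lee_fin; case/andP: (k01 t).
have D0 : 0 < sin b * cos b.
  by rewrite mulr_gt0 ?sin_gt0_pihalf ?b0// cos_gt0_pihalf// bpi andbT; lra.
(* [h] makes [h * (sin t * cos t)] agree with [k] at [b]; the slope is [h / 2] because [sin * cos]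
   has primitive [sin ^+ 2 / 2]. *)
pose h := k b / (sin b * cos b).
exists (h / 2) => c /andP[c0 cpi].
have int_h x y : x <= y -> \int[lebesgue_measure]_(t in `[x, y])
  (h * (sin t * cos t)) =
    h / 2 * (sin y ^+ 2 - sin x ^+ 2).
  by move=> xy; rewrite RintegralZl// Rintegral_sin_cos//; field.
have ihsc x y : lebesgue_measure.-integrable `[x, y]
    (EFin \o (fun t : R => h * (sin t * cos t))).
  rewrite (_ : EFin \o _ = fun t => (h%:E * (sin t * cos t)%:E)%E); last first.
    by apply/funext => t /=; rewrite EFinM.
  exact: (integrableZl _ h (isc x y)).
have [cb|bc] := leP c b.
  rewrite (splitk c b); last by rewrite cb ltW.
  rewrite addrC lerD2r -int_h//; apply: le_Rintegral => // t.
  rewrite /= in_itv/= => /andP[ct tb].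
  rewrite /h mulrAC ler_pdivrMr//; apply: kmono => //; last exact: ltW.
  exact: le_trans ct.
rewrite (splitk b c); last by rewrite cpi ltW.
rewrite addrAC gerDr -[_ * _]opprK -mulrN opprB -int_h ?(ltW bc)// subr_le0.
apply: le_Rintegral => // t; rewrite /= in_itv/= => /andP[bt tc].
rewrite /h mulrAC ler_pdivlMr//; apply: kmono => //; first exact: ltW.
exact: le_trans tc _.
Qed.

(** * Monotonicity of [r * (1 - F r)] for large [r] *)

Section cdf_tail.
Context {d : measure_display} {T : measurableType d} {R : realType}.
Variable P : probability T R.
Variable X : {RV P >-> R}.

Let F x := fine (cdf X x).

Lemma fine_cdfE x : (F x)%:E = cdf X x.
Proof. by rewrite fineK// fin_num_measure. Qed.

Lemma fine_cdf_homo x y : x <= y -> F x <= F y.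
Proof. by move=> xy; rewrite -lee_fin !fine_cdfE; exact: cdf_nondecreasing. Qed.

Lemma fine_cdf_le1 x : F x <= 1.
Proof. by rewrite -lee_fin fine_cdfE; exact: cdf_le1. Qed.

Lemma distribution_itvoy x : distribution P X `]x, +oo[ = (1 - F x)%:E.
Proof.
rewrite EFinB fine_cdfE /cdf -setCitvl probability_setC//.
Qed.

Lemma density_slope_le (f : R -> R) (m a b : R) : has_density X f ->
  a <= b -> 0 <= m -> (forall t, a <= t <= b -> m <= f t) -> m * (b - a) <= F b - F a.
Proof.
move=> [mf f0 XE] ab m0 fm.
have mE : measurable_fun setT (EFin \o f) by exact/measurable_EFinP.
rewrite -lee_fin EFinB !fine_cdfE leeBrDr; last first.
  by rewrite fin_num_measure.
rewrite !XE (@itv_bndbnd_setU _ _ -oo%O (BRight a) (BRight b))//.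
rewrite ge0_integral_setU//=; last 3 first.
- exact: measurable_funTS.
- by move=> x _; rewrite lee_fin.
- by apply/disj_setPRL => t/=; rewrite !in_itv/= => /andP[at_ _]; rewrite leNgt at_.
rewrite addeC leeD2l//.
apply: (@le_trans _ _ (\int[lebesgue_measure]_(t in `]a, b]) m%:E)%E).
  rewrite integral_cst//= lebesgue_measure_itv/= lte_fin.
  have [_|ba] := ltP a b; first by rewrite -EFinM.
  have -> : b = a by apply/le_anti; rewrite ab ba.
  by rewrite subrr mulr0 mule0.
apply: ge0_le_integral => //.
- exact: measurable_funTS.
- by move=> t /=; rewrite in_itv/= => /andP[/ltW at_ tb]; rewrite lee_fin fm// at_.
Qed.

(* Let [1 < c] be strictly below the liminf.  For [a <= b <= c * a], integrating
   [f t >= c * (1 - F b) / b] over [[a, b]] already gives the claim; the general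
   case iterates over [a * c ^+ n]. *)
Lemma cdf_tail_mulr_nonincreasing (f : R -> R) : has_density X f ->
  (1%:E < limf_einf (fun r : R => (r * f r / (1 - F r))%:E) (pinfty_nbhs R))%E ->
  exists2 r0, 0 < r0 & (forall r, r0 <= r -> F r < 1) /\
    forall a b, r0 <= a -> a <= b -> b * (1 - F b) <= a * (1 - F a).
Proof.
move=> Xf; rewrite limf_einfE => /ereal_sup_gt[_ [A [M [_ MA]] <-] infA].
have [c c1 fA] : exists2 c, 1 < c & forall r, A r -> c <= r * f r / (1 - F r).
  move: infA; set I := ereal_inf _ => infA.
  have IA r : A r -> (I <= (r * f r / (1 - F r))%:E)%E.
    by move=> Ar; apply: ereal_inf_lbound; exists r.
  case: I infA IA => [c|//|//]; first by rewrite lte_fin; exists c.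
  (* An infimum equal to [+oo] over real values leaves no point in [A], so any constant above 1
     serves. *)
  by move=> _ IA; exists 2 => [|r /IA]; [lra|rewrite leye_eq].
(* [A] contains every point strictly beyond [M]; the 1 keeps the threshold positive. *)
exists (Num.max 1 (M + 1)); first by rewrite lt_max ltr01.
set r0 := Num.max _ _.
have r01 : 1 <= r0 by rewrite le_max lexx.
have r0A r : r0 <= r -> A r.
  by move=> r0r; apply: MA; rewrite (lt_le_trans _ r0r)// lt_max ltrDl ltr01 orbT.
(* Division by zero returns 0, so [F r = 1] would make the quotient 0, below [c]. *)
have F1 r : r0 <= r -> F r < 1.
  move=> r0r; rewrite lt_neqAle fine_cdf_le1 andbT; apply/eqP => Fr1.
  by have := fA r (r0A r r0r); rewrite Fr1 subrr invr0 mulr0 leNgt (lt_trans _ c1).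
have fc r : r0 <= r -> c * (1 - F r) <= r * f r.
  by move=> r0r; rewrite -ler_pdivlMr ?subr_gt0 ?F1//; exact/fA/r0A.
split=> //.
have loc a b : r0 <= a -> a <= b -> b <= c * a -> b * (1 - F b) <= a * (1 - F a).
  move=> r0a ab bca.
  have a0 : 0 < a by apply: lt_le_trans r0a; lra.
  have b0 : 0 < b by exact: lt_le_trans ab.
  have Fb0 : 0 < 1 - F b by rewrite subr_gt0 F1//; exact: le_trans ab.
  have slope : c * (1 - F b) / b * (b - a) <= F b - F a.
    apply: (@density_slope_le f) => //;
      first by rewrite !mulr_ge0 ?invr_ge0 ?ltW//; lra.
    move=> t /andP[at_ tb]; have t0 : 0 < t by exact: lt_le_trans at_.
    have ft : c * (1 - F t) <= t * f t by apply: fc; exact: le_trans at_.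
    have Ft := fine_cdf_homo _ _ tb.
    have f0 : 0 <= f t by case: Xf.
    rewrite ler_pdivrMr// (le_trans (y := t * f t))//.
      by apply: le_trans ft; rewrite ler_pM2l//; lra.
    by rewrite mulrC ler_wpM2l.
  (* The factor [c * a / b] is at least 1: this is where [b <= c * a] enters. *)
  have : a * (c * (1 - F b) / b * (b - a)) >= (1 - F b) * (b - a).
    rewrite [leRHS](_ : _ = (1 - F b) * (b - a) * (c * a / b));
      last by field; rewrite gt_eqF.
    rewrite ler_peMr//; first by rewrite mulr_ge0 ?subr_ge0 ?fine_cdf_le1.
    by rewrite ler_pdivlMr// mul1r.
  have := ler_wpM2l (ltW a0) slope; nra.
have iter n a b : r0 <= a -> a <= b -> b <= c ^+ n * a -> b * (1 - F b)
  <= a * (1 - F a).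
  elim: n a b => [|n IH] a b r0a ab.
    by rewrite expr0 mul1r => ba; have -> : a = b by apply/le_anti; rewrite ab ba.
  have [bca _|cab] := leP b (c * a); first exact: loc.
  have a0 : 0 < a by apply: lt_le_trans r0a; lra.
  have aca : a <= c * a by rewrite ler_peMl// ltW.
  rewrite exprSr -mulrA => bca; apply: le_trans (loc a (c * a) r0a aca _) => //.
  by apply: IH => //; [exact: le_trans aca|exact: ltW].
move=> a b r0a ab.
have a0 : 0 < a by apply: lt_le_trans r0a; lra.
(* Bernoulli's inequality together with the Archimedean property bounds the number of iterations. *)
have [n] : exists n, b / a <= c ^+ n.
  have bernoulli n : 1 + n%:R * (c - 1) <= c ^+ n.
    elim: n => [|n IH]; first by rewrite mul0r addr0.
    rewrite exprS; apply: le_trans (ler_wpM2l _ IH); last by lra.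
    by rewrite -natr1; have := mulr_ge0 (ler0n R n) (sqr_ge0 (c - 1)); nra.
  exists (Num.bound (b / a / (c - 1))).
  apply: le_trans (bernoulli _); rewrite -lerBlDl -ler_pdivrMr; last by lra.
  apply: le_trans (ltW (archi_boundP _)).
    by rewrite ler_pM2r ?invr_gt0 ?subr_gt0// gerBl.
  by rewrite !divr_ge0//; lra.
by rewrite ler_pdivrMr//; exact: iter.
Qed.
End cdf_tail.

(** * Probabilities in polar coordinates *)

Section polar_decomposition.
Context {d : measure_display} {T : measurableType d} {R : realType}.
Variable P : probability T R.
Variables Rad Theta : {RV P >-> R}.
Hypothesis Rad_gt0 : {ae P, forall w, 0 < Rad w}.
Hypothesis Theta_uniform : uniform_RV (- pi) pi Theta.
Hypothesis Rad_Theta_indep : independent_RV Rad Theta.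
Local Notation law := (distribution P Rad).

(** Independence makes the joint law a product measure; iterating with the angle outermost leaves
    the law of the radius on each section. *)
Lemma polar_law (A : set (R * R)) : measurable A ->
  P [set w | A (Rad w, Theta w)] =
  (((pi *+ 2)^-1)%:E *
    \int[lebesgue_measure]_(t in `[(- pi)%R, pi]) law (ysection A t))%E.
Proof.
move=> mA.
(* [uniform_prob] lives on [measurableTypeR R], whose display differs from that
   of [R], hence the retyping of [Theta] *)
have mTheta : measurable_fun setT (Theta : T -> measurableTypeR R).
  exact: (@measurable_funPT _ _ _ _ Theta).
pose Th : {mfun T >-> measurableTypeR R} :=
  mfun_Sub (mem_set mTheta : (Theta : T -> measurableTypeR R) \in mfun).
have mRT : measurable_fun setT (fun w => (Rad w, Th w)).
  by apply/measurable_fun_pairP; split; exact: measurable_funPT.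
pose RT := mfun_Sub (mem_set mRT : _ \in mfun).
have mA' : measurable (A : set (R * measurableTypeR R)) by exact: mA.
have joint : (law \x distribution P Th)%E A = distribution P RT A.
  by apply: product_measure_unique => // B C mB mC; exact: Rad_Theta_indep.
have -> : P [set w | A (Rad w, Theta w)] = distribution P RT A by [].
rewrite -joint.
transitivity ((law \x^ distribution P Th)%E A).
  apply: product_measure_unique => // B C mB mC.
  exact: product_measure2E.
rewrite /product_measure2.
have [pp unif] := Theta_uniform.
transitivity (\int[uniform_prob pp]_t (law \o ysection A) t)%E.
  by apply: eq_measure_integral => B mB _; exact: unif.
rewrite integral_uniform//; last exact: measurable_fun_ysection.
by rewrite opprK -mulr2n.
Qed.

(** The radius is almost surely positive, so nonpositive [r] carry no mass and inclusion has to be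
    checked for positive [r] only. *)
Lemma law_le (A B : set R) : measurable A -> measurable B ->
  (forall r, 0 < r -> A r -> B r) -> (law A <= law B)%E.
Proof.
move=> mA mB AB.
have neg0 : law `]-oo, 0] = 0.
  have [N [mN N0 RadN]] := Rad_gt0.
  apply/eqP; rewrite -measure_le0 -N0.
  apply: (@le_measure _ _ _ P); rewrite ?inE//; first exact: measurable_funPTI.
  by move=> w /=; rewrite in_itv/= => Rw; apply: RadN => /=; rewrite ltNge Rw.
apply: (@le_trans _ _ (law (B `|` `]-oo, 0]))).
  apply: (@le_measure _ _ _ law); rewrite ?inE//; first exact: measurableU.
  move=> r Ar; have [r0|r0] := ltP 0 r; [left; exact: AB|right].
  by rewrite /= in_itv.
rewrite -[leRHS]adde0 -neg0; apply: measureU2 => //.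
Qed.

Section lower_tail_set.
Variable S : set R.
Hypothesis mS : measurable S.
Hypothesis S_down : forall x y, x <= y -> S y -> S x.
Variable r0 : R.
Hypothesis r0_gt0 : 0 < r0.
Hypothesis S_lt : forall x, S x -> x < - r0.

(** At [c = - cos t] this is the function [k] of the overview. [S] stands for a sublevel set of the
    marginal distribution function; as a down-set it may or may not contain its supremum. *)
Definition scaled_law (c : R) : \bar R := law [set r | S (r * c)].

Lemma measurable_scaled (c : R) : measurable [set r | S (r * c)].
Proof.
have mc : measurable_fun setT (fun r : R => r * c) by exact: measurable_funM.
by rewrite -[X in measurable X]setTI; exact: mc.
Qed.

Lemma measurable_scaled_law : measurable_fun setT scaled_law.
Proof.
have mM : measurable_fun setT (fun z : R * R => z.1 * z.2) by exact: measurable_funM.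
have mA : measurable [set z : R * R | S (z.1 * z.2)].
  by rewrite -[X in measurable X]setTI; exact: mM.
have := measurable_fun_ysection law mA; congr (measurable_fun _ _).
apply/funext => c /=; congr (law _); apply/seteqP; split => r /=.
  by move/ysectionP.
by move=> ?; apply/ysectionP.
Qed.

Lemma scaled_law_fin_num c : scaled_law c \is a fin_num.
Proof. by rewrite fin_num_measure//; exact: measurable_scaled. Qed.

Lemma fine_scaled_law_itv c : 0 <= fine (scaled_law c) <= 1.
Proof.
rewrite fine_ge0 ?measure_ge0//= -lee_fin fineK ?scaled_law_fin_num//.
by apply: probability_le1; exact: measurable_scaled.
Qed.

Lemma measurable_scaled_law_cos :
  measurable_fun setT (fun t => fine (scaled_law (- cos t))).
Proof.
apply: measurableT_comp => //; apply: (measurableT_comp measurable_scaled_law).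
by apply: measurableT_comp => //;
  exact: continuous_measurable_fun (@continuous_cos R).
Qed.

Lemma scaled_law_eq0 c : 0 <= c -> scaled_law c = 0%E.
Proof.
move=> c0; apply/eqP; rewrite -measure_le0 -(measure0 law).
apply: law_le => // [|r rgt0 /= /S_lt]; first exact: measurable_scaled.
by move=> rc; exfalso; have := mulr_ge0 (ltW rgt0) c0; move: r0_gt0; lra.
Qed.

Lemma scaled_law_max (c e : R) :
  law [set r | S (r * c) /\ S (r * e)] = scaled_law (Num.max c e).
Proof.
have mI : measurable [set r | S (r * c) /\ S (r * e)].
  by apply: measurableI; exact: measurable_scaled.
apply/le_anti/andP; split; apply: law_le => //; try exact: measurable_scaled.
  by move=> r _ [Sc Se] /=; case: (leP c e).
by move=> r rgt0 /= Sm; split; apply: S_down Sm; rewrite ler_pM2l// le_max lexx ?orbT.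
Qed.

(** At a fixed angle the two events merge into the one with the larger cosine. The circle then folds
    onto two copies of the arc [[b, pi / 2]], which turns the density [1 / (2 pi)] into [1 / pi]. *)
Lemma polar_wedge (b : R) : 0 <= b <= pi / 2 ->
  P [set w | S (Rad w * cos (Theta w)) /\ S (Rad w * cos (Theta w - b *+ 2))] =
  (pi^-1 * \int[lebesgue_measure]_(t in `[b, pi / 2]) fine (scaled_law (- cos t)))%:E.
Proof.
move=> bpi.
have mcos (c : R) : measurable_fun setT (fun z : R * R => z.1 * cos (z.2 - c)).
  apply: measurable_funM => //; apply: measurableT_comp.
    exact: continuous_measurable_fun (@continuous_cos R).
  exact: measurable_funB.
have mA : measurable [set z : R * R | S (z.1 * cos z.2) /\
  S (z.1 * cos (z.2 - b *+ 2))].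
  apply: measurableI; rewrite -[X in measurable X]setTI; last exact: mcos.
  by have := mcos 0 measurableT _ mS; under [X in _ `&` X]eq_set do rewrite subr0.
rewrite (polar_law _ mA).
under eq_integral => t _.
  rewrite (_ : ysection _ _ = [set r | S (r * cos t) /\
    S (r * cos (t - b *+ 2))]); last first.
    by apply/seteqP; split => r /=; [move/ysectionP|move=> ?; apply/ysectionP].
  rewrite scaled_law_max.
  over.
rewrite (ge0_integral_circle_max _ _ _ measurable_scaled_law)//; last exact: scaled_law_eq0.
have mk := measurable_scaled_law_cos.
have -> : (\int[lebesgue_measure]_(t in `[b, (pi / 2)%R]) scaled_law (- cos t)%R =
    (\int[lebesgue_measure]_(t in `[b, pi / 2]) fine (scaled_law (- cos t)))%:E)%E.
  rewrite /Rintegral fineK; first by apply: eq_integral => t _; rewrite fineK// scaled_law_fin_num.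
  apply: integrable_fin_num => //; apply: measurable_bounded_integrable => //.
  - by rewrite /= lebesgue_measure_itv/=; case: ifP; rewrite ltry.
  - exact: measurable_funTS.
  - exists 1; split=> // M M1 t _ /=;
      have /andP[k0 k1] := fine_scaled_law_itv (- cos t).
    by rewrite ger0_norm// (le_trans k1)// ltW.
rewrite mule2n -EFinD -EFinM; congr (_%:E).
have : pi != 0 :> R by rewrite gt_eqF// pi_gt0.
by move: pi => c c0; field.
Qed.

(** With [q = - sup S], this compares [r * P (Rad > r)] at [q / e] and [q / c], both beyond [r0]
    since [e <= 1]. As [S] may contain its supremum, [scaled_law (- c)] is only bounded by the tails
    at [b < q / c], and [b] then tends to [q / c]. *)
Lemma scaled_law_le_mul (F := fun x => fine (cdf Rad x)) (c e : R) :
  (forall a b, r0 <= a -> a <= b -> b * (1 - F b) <= a * (1 - F a)) ->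
  0 < c -> c < e -> e <= 1 ->
  e * fine (scaled_law (- c)) <= c * fine (scaled_law (- e)).
Proof.
move=> Fmono c0 ce e1; have e0 := lt_trans c0 ce.
have /andP[Kc0 _] := fine_scaled_law_itv (- c).
have /andP[Ke0 _] := fine_scaled_law_itv (- e).
(* The empty set is treated apart, since [sup S] is meaningful only for nonempty [S]. *)
have [S0|/set0P[x0 Sx0]] := eqVneq S set0.
  have -> : scaled_law (- c) = 0%E by rewrite /scaled_law S0; exact: measure0.
  by rewrite mulr0 mulr_ge0// ltW.
have supS : has_sup S by split; [exists x0|exists (- r0) => x /S_lt /ltW].
pose q := - sup S.
have r0q : r0 <= q by rewrite lerNr; apply: ge_sup; [exists x0|move=> x /S_lt /ltW].
have q0 : 0 < q := lt_le_trans r0_gt0 r0q.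
have mK x := measurable_scaled x.
have lower : 1 - F (q / e) <= fine (scaled_law (- e)).
  rewrite -lee_fin fineK ?scaled_law_fin_num// -distribution_itvoy.
  apply: law_le => // r rgt0; rewrite /= in_itv/= andbT ltr_pdivrMr// => qre.
  have [s Ss sre] : exists2 s, S s & - (r * e) < s.
    have qre0 : 0 < r * e - q by rewrite subr_gt0.
    have [s Ss sres] := sup_adherent qre0 supS.
    by exists s => //; move: sres; rewrite /q; lra.
  by apply: S_down Ss; rewrite mulrN ltW.
have upper b : q / e <= b -> b < q / c -> fine (scaled_law (- c)) <= 1 - F b.
  move=> qb bq; rewrite -lee_fin fineK ?scaled_law_fin_num// -distribution_itvoy.
  apply: law_le => // r rgt0 /= Src; rewrite in_itv/= andbT (lt_le_trans bq)//.
  rewrite ler_pdivrMr// /q lerNl -mulrN; exact: ub_le_sup supS.2 _ Src.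
have r0qe : r0 <= q / e.
  by rewrite (le_trans r0q)// ler_pdivlMr// ler_piMr// ltW.
have qec : q / e < q / c by rewrite ltr_pM2l// ltf_pV2.
have key : q / c * fine (scaled_law (- c)) <= q / e * fine (scaled_law (- e)).
  have bound b : q / e <= b -> b < q / c ->
      b * fine (scaled_law (- c)) <= q / e * fine (scaled_law (- e)).
    move=> qb bq; apply: (@le_trans _ _ (b * (1 - F b))).
      by rewrite ler_wpM2l ?upper// (le_trans _ qb)// divr_ge0// ltW.
    apply: le_trans (Fmono _ _ r0qe qb) _.
    by rewrite ler_wpM2l// divr_ge0// ltW.
  move: Kc0; rewrite le_eqVlt => /predU1P[<-|Kc0].
    by rewrite mulr0 mulr_ge0// divr_ge0// ltW.
  rewrite -ler_pdivlMr//; apply/ler_addgt0Pl => eps eps0; rewrite addrC -lerBlDr.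
  (* If [q / c - eps] falls below [q / e], the bound at [b = q / e] is already enough. *)
  have [qb|bq] := leP (q / e) (q / c - eps).
    by rewrite ler_pdivlMr//; apply: bound => //; rewrite ltrBlDr ltrDl.
  by rewrite (le_trans (ltW bq))// ler_pdivlMr// bound.
have := ler_wpM2l (ltW (mulr_gt0 c0 e0)) key.
rewrite (_ : c * e * (_ / c * _) = q * (e * fine (scaled_law (- c))));
  last by field; rewrite gt_eqF.
rewrite (_ : c * e * (_ / e * _) = q * (c * fine (scaled_law (- e))));
  last by field; rewrite gt_eqF.
by rewrite ler_pM2l.
Qed.

(** The previous comparison, taken at the cosines of [x] and [y], shows that [k / cos] is
    nonincreasing; dividing further by the increasing sine preserves this. At [cos y = 0] the left
    side vanishes. *)
Lemma scaled_law_arc (F := fun x => fine (cdf Rad x)) (x y : R) :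
  (forall a b, r0 <= a -> a <= b -> b * (1 - F b) <= a * (1 - F a)) ->
  0 <= x -> x <= y -> y <= pi / 2 ->
  fine (scaled_law (- cos y)) * (sin x * cos x) <=
  fine (scaled_law (- cos x)) * (sin y * cos y).
Proof.
move=> Fmono x0; rewrite le_eqVlt => /predU1P[->//|xy ypi].
have pi0 := pi_gt0 R.
have sx : 0 <= sin x by apply: sin_ge0_pi; apply/andP; split; lra.
have sy : 0 <= sin y by apply: sin_ge0_pi; apply/andP; split; lra.
have sxy : sin x <= sin y.
  by rewrite ltW// ltr_sin// in_itv/=; apply/andP; split; lra.
have cxy : cos y < cos x.
  by rewrite ltr_cos// in_itv/=; apply/andP; split; lra.
have : 0 <= cos y by apply: cos_ge0_pihalf; apply/andP; split; lra.
have /andP[Kx0 _] := fine_scaled_law_itv (- cos x).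
have /andP[Ky0 _] := fine_scaled_law_itv (- cos y).
rewrite le_eqVlt => /predU1P[cy0|cy0].
  by rewrite -cy0 oppr0 scaled_law_eq0// !mulr0 mul0r.
have := scaled_law_le_mul _ _ Fmono cy0 cxy (cos_le1 x).
move: (fine _) (fine _) Kx0 Ky0 => kx ky kx0 ky0 key.
have := ler_wpM2l sx key; have := ler_wpM2r (mulr_ge0 (ltW cy0) kx0) sxy.
nra.
Qed.

End lower_tail_set.
End polar_decomposition.

(** * Pointwise limits of convex functions *)

Lemma lim_convex_function (R : realType) (I : topologicalType) (G : set_system I)
    (GP : ProperFilter G) (a b : R) (phi : I -> R -> R) (psi : R -> R) :
  (\forall i \near G, @convex_function R R^o `[a, b] (phi i)) ->
  (forall x, a <= x <= b -> phi i x @[i --> G] --> psi x) ->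
  @convex_function R R^o `[a, b] psi.
Proof.
move=> cvx lim t x y xab yab.
have x' : a <= x <= b by move: xab; rewrite inE/= in_itv.
have y' : a <= y <= b by move: yab; rewrite inE/= in_itv.
have cvx' : \forall i \near G, phi i (t%:inum * x + (1 - t%:inum) * y) <=
    t%:inum * phi i x + (1 - t%:inum) * phi i y.
  near=> i.
  have ci : @convex_function R R^o `[a, b] (phi i) by near: i.
  by have := ci t x y xab yab; rewrite !convRE.
rewrite !convRE.
change (psi (t%:inum * x + (1 - t%:inum) * y) <=
  t%:inum * psi x + (1 - t%:inum) * psi y).
have t01 : 0 <= t%:inum <= 1 by apply/andP.
move: (t%:inum) t01 cvx' => p /andP[p0 p1] cvx'.
have mab : a <= p * x + (1 - p) * y <= b.
  by case/andP: x' => ? ?; case/andP: y' => ? ?; apply/andP; split; nra.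
have limxy : p * phi i x + (1 - p) * phi i y @[i --> G] -->
    p * psi x + (1 - p) * psi y.
  by apply: cvgD; apply: cvgM; [exact: cvg_cst|exact: lim|exact: cvg_cst|exact: lim].
exact: ler_cvg_to (lim _ mab) limxy cvx'.
Unshelve. all: by end_near.
Qed.

(** * Convexity of the penultimate coefficient in the correlation *)

Section elliptical_copula_convexity.
Context {d : measure_display} {T : measurableType d} {R : realType}.
Variable P : probability T R.
Variables Rad Theta : {RV P >-> R}.
Hypothesis Rad_gt0 : {ae P, forall w, 0 < Rad w}.
Hypothesis Theta_uniform : uniform_RV (- pi) pi Theta.
Hypothesis Rad_Theta_indep : independent_RV Rad Theta.
Let F x := fine (cdf Rad x).
Let FX := elliptical_cdf Rad Theta.

Lemma elliptical_cdf_homo x y : x <= y -> FX x <= FX y.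
Proof. exact: fine_cdf_homo. Qed.

Lemma elliptical_Y_polar (rho : R) (w : T) : -1 <= rho <= 1 ->
  elliptical_Y Rad Theta rho w = Rad w * cos (Theta w - acos rho).
Proof.
move=> rho1; rewrite /elliptical_Y /spherical1 /spherical2 cosB sin_acos//.
by rewrite acosK ?in_itv//; ring.
Qed.

(** The event that [Rad] exceeds [2 * r] while [Theta] lies in [[2 pi / 3, pi]], where the cosine is
    at most [- 1 / 2], has positive probability by independence and forces the first coordinate
    below [- r]. *)
Lemma elliptical_cdf_gt0 (r : R) : 0 < r -> F (2 * r) < 1 -> 0 < FX (- r).
Proof.
move=> r0 F1.
have cI : -1 <= (- 2^-1 : R) <= 1 by lra.
have c1 : cos (acos (- 2^-1)) = - 2^-1 :> R by rewrite acosK// in_itv.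
have a0 : 0 <= acos (- 2^-1) :> R by exact: acos_ge0.
have api : acos (- 2^-1) < pi :> R.
  by rewrite acos_ltpi//; lra.
rewrite -lte_fin fine_cdfE.
have mO : measurable `]2 * r, +oo[ by [].
have mA : measurable `[acos (- 2^-1), pi : R] by [].
apply: (@lt_le_trans _ _ (P (Rad @^-1` `]2 * r, +oo[ `&`
  Theta @^-1` `[acos (- 2^-1), pi]))).
  rewrite Rad_Theta_indep// mule_gt0//.
    by rewrite -[X in (0 < X)%E]/(distribution P Rad _) distribution_itvoy
      lte_fin subr_gt0.
  rewrite -[X in (0 < X)%E]/(distribution P Theta _).
  have [pp ->//] := Theta_uniform.
  rewrite /uniform_prob (eq_integral (fun=> (pi + pi)^-1%:E)); last first.
    move=> x; rewrite inE/= in_itv/= => /andP[x1 x2].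
    by rewrite /uniform_pdf x2 opprK ifT// andbT; have := pi_gt0 R; lra.
  rewrite integral_cst//= lebesgue_measure_itv/= lte_fin api.
  by rewrite -EFinB -EFinM lte_fin mulr_gt0 ?invr_gt0 ?subr_gt0// addr_gt0 ?pi_gt0.
apply: (@le_measure _ _ _ P); rewrite ?inE.
- by apply: measurableI; exact: measurable_funPTI.
- exact: measurable_funPTI.
move=> w [] /=; rewrite !in_itv/= andbT => Rw /andP[Tw1 Tw2].
have : cos (Theta w) <= - 2^-1.
  rewrite -c1; move: Tw1; rewrite le_eqVlt => /predU1P[->//|Tw1].
  by apply/ltW; rewrite ltr_cos// in_itv/= ?(ltW api) ?a0// Tw2 (le_trans a0)// ltW.
by rewrite /spherical1; nra.
Qed.

Lemma penultimate_tail_dependence_convex (r0 u : R) : 0 < r0 ->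
  (forall a b, r0 <= a -> a <= b -> b * (1 - F b) <= a * (1 - F a)) ->
  0 < u < FX (- r0) ->
  @convex_function R R^o `[-1, 1]
    (fun rho : R => penultimate_tail_dependence Rad Theta rho u).
Proof.
move=> r0_gt0 Fmono /andP[u0 ur0].
pose S := [set x | FX x <= u].
have mS : measurable S.
  rewrite (_ : S = FX @^-1` `]-oo, u]); last first.
    by apply/seteqP; split=> x /=; rewrite in_itv.
  rewrite -[X in measurable X]setTI.
  have mFX : measurable_fun setT FX.
    by apply: nondecreasing_measurable => // x y xy; exact: elliptical_cdf_homo.
  exact: mFX.
have S_down x y : x <= y -> S y -> S x.
  by move=> xy; apply: le_trans; exact: elliptical_cdf_homo.
(* Smallness of [u] places the whole sublevel set in the range where the tail is controlled. *)
have S_lt x : S x -> x < - r0.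
  move=> Sx; rewrite ltNge; apply/negP => rx; move: ur0.
  by rewrite ltNge (le_trans _ Sx)// elliptical_cdf_homo.
pose k t := fine (scaled_law P Rad S (- cos t)).
have copulaE rho : -1 <= rho <= 1 ->
    penultimate_tail_dependence Rad Theta rho u =
    (u * pi)^-1 * \int[lebesgue_measure]_(t in `[acos rho / 2, pi / 2]) k t.
  move=> rho1; rewrite /penultimate_tail_dependence /elliptical_copula.
  rewrite (_ : [set w | _] = [set w | S (Rad w * cos (Theta w)) /\
      S (Rad w * cos (Theta w - (acos rho / 2) *+ 2))]); last first.
    by apply/seteqP; split => w /=; rewrite elliptical_Y_polar// -mulr_natr divfK.
  rewrite (polar_wedge _ _ _ Rad_gt0
    Theta_uniform Rad_Theta_indep _ mS S_down _ r0_gt0 S_lt).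
    by rewrite /= invfM mulrA.
  by rewrite divr_ge0 ?acos_ge0//= ler_pM2r// acos_lepi.
apply: subgradient_convex => rho /andP[rho0 rho1].
have rhoI : -1 <= rho <= 1 by rewrite !ltW.
have sinE (x : R) : -1 <= x <= 1 -> sin (acos x / 2) ^+ 2 = (1 - x) / 2.
  move=> x1; have := cos_mulr2n (acos x / 2).
  rewrite -[_ / 2 *+ 2]mulr_natr divfK// acosK ?in_itv// cos2sin2; lra.
have b_itv : 0 < acos rho / 2 < pi / 2.
  by rewrite divr_gt0 ?acos_gt0 ?rho1 ?andbT ?ltW//= ltr_pM2r// acos_ltpi// rho0 ltW.
have mk : measurable_fun setT k by exact: measurable_scaled_law_cos.
have [t||s sub] := arc_integral_subgradient _ _ _ mk _ _ b_itv.
- exact: fine_scaled_law_itv.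
- move=> x y x0 xy ypi.
  exact: (scaled_law_arc _ _ Rad_gt0 _ mS S_down r0).
(* By the half-angle formula [sinE], the difference of squared sines equals [(x - rho) / 2], so a
   subgradient in the squared sine becomes one in [rho]. *)
exists ((u * pi)^-1 * (s / 2)) => x x1.
rewrite !copulaE// -mulrA -mulrDr ler_pM2l;
  last by rewrite invr_gt0 mulr_gt0// pi_gt0.
have c_itv : 0 <= acos x / 2 <= pi / 2.
  by rewrite divr_ge0 ?acos_ge0//= ler_pM2r// acos_lepi.
apply: le_trans (sub _ c_itv); rewrite !sinE// le_eqVlt; apply/orP; left; apply/eqP.
by field.
Qed.

End elliptical_copula_convexity.

Theorem proposition2 (R : realType) (d : measure_display)
    (T : measurableType d) (P : probability T R)
    (Rad Theta : {RV P >-> R}) (f : R -> R)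
    (Rad_gt0 : {ae P, forall w, 0 < Rad w})
    (Theta_uniform : uniform_RV (- pi) pi Theta)
    (Rad_Theta_indep : independent_RV Rad Theta)
    (Rad_unbounded : ~ bounded_set (cdf_support Rad))
    (Rad_density : has_density Rad f)
    (liminf_gt1 :
      (1%:E < limf_einf (fun r : R => (r * f r / (1 - fine (cdf Rad r)))%:E)
                        (pinfty_nbhs R))%E) :
  (exists2 u0 : R, 0 < u0 < 2^-1 &
    forall u : R, 0 < u < u0 ->
      @convex_function R R^o `[-1, 1]
        (fun rho : R => penultimate_tail_dependence Rad Theta rho u)) /\
  ((forall rho : R, -1 <= rho <= 1 ->
      cvg (penultimate_tail_dependence Rad Theta rho u @[u --> 0^'+])) ->
    @convex_function R R^o `[-1, 1] (tail_dependence Rad Theta)).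
Proof.
have [r0 r0_gt0 [F1 Fmono]] := cdf_tail_mulr_nonincreasing _ _ _ Rad_density liminf_gt1.
(* The value [4^-1] keeps [u0] strictly below one half; the other term is positive because
   [F (2 * r0) < 1]. *)
pose u0 := Num.min (4^-1) (elliptical_cdf Rad Theta (- r0)).
have u0_gt0 : 0 < u0.
  rewrite lt_min invr_gt0 ltr0n/=; apply: elliptical_cdf_gt0 => //.
  by apply: F1; lra.
have cvx u : 0 < u < u0 -> @convex_function R R^o `[-1, 1]
    (fun rho : R => penultimate_tail_dependence Rad Theta rho u).
  rewrite lt_min => /and3P[u_gt0 _ ur0].
  apply: (penultimate_tail_dependence_convex _ _ _ Rad_gt0 Theta_uniform
    Rad_Theta_indep r0) => //.
  by rewrite u_gt0.
split.
  exists u0 => //; rewrite u0_gt0/= gt_min; apply/orP; left; lra.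
move=> cv.
apply: (@lim_convex_function _ R 0^'+ _ _ _
  (fun u rho => penultimate_tail_dependence Rad Theta rho u)) => //.
near=> u; apply: cvx; apply/andP; split; near: u.
- exact: nbhs_right_gt.
- exact: nbhs_right_lt.
Unshelve. all: by end_near.
Qed.
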